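(* Let $r\ge 1$, let $A$ be a real $r\times r$ matrix and let $R,S$ be real symmetric positive semi-definite $r\times r$ matrices such that $(A,R^{1/2})$ is controllable and $(A,S^{1/2})$ is observable. Let $P_\infty,\widehat P_\infty$ be the unique positive definite fixed points of the Riccati maps $\Phi,\widehat\Phi$, and set $H:=(P_\infty+\widehat P_\infty^{-1})^{-1}$, $E:=A(I+P_\infty S)^{-1}$, $F:=S(I+P_\infty S)^{-1}$. Then $H$ is the unique solution (among real $r\times r$ matrices $X$) of the discrete time algebraic Lyapunov equation $X=E^{\prime}XE+F$; in particular $$H=E^{\prime}HE+F.$$
   Context: All matrices are real $r\times r$; $M'$ denotes the transpose of $M$. $\mathcal{S}^0_r$ is the set of symmetric positive semi-definite matrices. $R^{1/2}$, $S^{1/2}$ are symmetric square roots of $R,S$. Controllability of $(A,R^{1/2})$ means that $[R^{1/2},AR^{1/2},\ldots,A^{r-1}R^{1/2}]$ has rank $r$; observability of $(A,S^{1/2})$ means that the matrix obtained by stacking $S^{1/2},S^{1/2}A,\ldots,S^{1/2}A^{r-1}$ vertically has rank $r$. For $P,Q\in\mathcal{S}^0_r$ the matrix $I+PQ$ is invertible. The Riccati maps $\Phi,\widehat\Phi:\mathcal{S}^0_r\to\mathcal{S}^0_r$ are $$\Phi(P):=A(I+PS)^{-1}PA'+R,\qquad \widehat\Phi(P):=A'(I+PR)^{-1}PA+S.$$ It is a well-known fact that, when $(A,R^{1/2})$ is controllable and $(A,S^{1/2})$ is observable, $\Phi$ and $\widehat\Phi$ each have a unique positive definite fixed point, denoted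 $P_\infty=\Phi(P_\infty)$ and $\widehat P_\infty=\widehat\Phi(\widehat P_\infty)$, and that $E:=A(I+P_\infty S)^{-1}$ has spectral radius strictly less than $1$. *)

(* Defs.v *)
From mathcomp Require Import all_boot all_order all_algebra.
From mathcomp Require Import reals.

Set Implicit Arguments.
Unset Strict Implicit.
Unset Printing Implicit Defensive.

Import GRing.Theory Num.Theory.
Local Open Scope ring_scope.

Definition psdmx (K : realType) (r : nat) (M : 'M[K]_r) : Prop :=
  M^T = M /\ forall x : 'cV[K]_r, 0 <= (x^T *m M *m x) 0 0.

Definition posdefmx (K : realType) (r : nat) (M : 'M[K]_r) : Prop :=
  M^T = M /\ forall x : 'cV[K]_r, x != 0 -> 0 < (x^T *m M *m x) 0 0.

(* The root is not required to be positive semi-definite: all symmetric square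
   roots of M have the same range, so controllability and observability below
   do not depend on the choice. *)
Definition symmetric_sqrtmx (K : realType) (r : nat) (M N : 'M[K]_r) : Prop :=
  N^T = N /\ N *m N = M.

Definition controllable (K : realType) (r : nat) (A B : 'M[K]_r) : Prop :=
  \rank (\mxrow_(k < r) (A ^+ k *m B)) = r.

Definition observable (K : realType) (r : nat) (A C : 'M[K]_r) : Prop :=
  \rank (\mxcol_(k < r) (C *m A ^+ k)) = r.

(* For positive semi-definite P and S the matrix 1%:M + P *m S is invertible,
   so invmx never takes its default value where these maps are used. *)
Definition riccati (K : realType) (r : nat) (A R S P : 'M[K]_r) : 'M[K]_r :=
  A *m invmx (1%:M + P *m S) *m P *m A^T + R.

Definition riccati_dual (K : realType) (r : nat) (A R S P : 'M[K]_r)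
  : 'M[K]_r :=
  A^T *m invmx (1%:M + P *m R) *m P *m A + S.

(* Main.v *)
Require Import Defs.
From mathcomp Require Import all_boot all_order all_algebra.
From mathcomp Require Import reals.

Set Implicit Arguments.
Unset Strict Implicit.
Unset Printing Implicit Defensive.

Import Order.TTheory GRing.Theory Num.Theory.
Local Open Scope ring_scope.

(** With [W = (P^-1 + S)^-1], [V = P^-1 + Phat] and [T = (Phat^-1 + R)^-1], the
    two Riccati equations read [P = A W A' + R] and [Phat = A' T A + S]. The
    Woodbury formula applied to [P + Phat^-1 = T^-1 + A W A'] gives
    [W A' H A W = W - V^-1]; applied to [P + Phat^-1] itself it gives
    [H = P^-1 - P^-1 V^-1 P^-1]. Since [E = A W P^-1] and
    [F = P^-1 - P^-1 W P^-1], the Lyapunov equation follows.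

    Uniqueness is proved without eigenvalues. The fixed point equation is also
    [P = E P E' + C] with [C = E P S P E' + R]. If [X = E' X E], expanding
    [tr (P X P X')] with both expressions of [P] and cancelling leaves two
    nonnegative terms with zero sum, and forces [R^(1/2) X = 0] and
    [S^(1/2) P E' X = 0], whence [A' X = E' X]. The matrices [E'^k X] solve the
    same equation, so [R^(1/2) A'^k X = 0] for all [k], and controllability
    gives [X = 0]. *)

(** * Inversion formulas and the Lyapunov identity *)

Section MatrixIdentities.

Variables (K : comUnitRingType) (r : nat).
Implicit Types A P Q R S T U W : 'M[K]_r.

Lemma invmx_mul_unit P Q :
  P \in unitmx -> Q \in unitmx -> invmx (P *m Q) = invmx Q *m invmx P.
Proof.
move=> uP uQ; have uPQ : P *m Q \in unitmx by rewrite unitmx_mul uP.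
by rewrite -[RHS](mulmxK uPQ) -!mulmxA (mulmxA (invmx P)) (mulVmx uP) mul1mx
  (mulmxA (invmx Q)) (mulVmx uQ) mul1mx.
Qed.

(** The factorization [1 + P S = P (P^-1 + S)] trades a nonsymmetric matrix for a sum to which
    positivity arguments apply. *)
Lemma unitmx_add1_mul P S :
  P \in unitmx -> invmx P + S \in unitmx -> 1%:M + P *m S \in unitmx.
Proof.
by move=> uP uS; rewrite -(mulmxV uP) -mulmxDr unitmx_mul uP.
Qed.

Lemma invmx_add1_mul P S : P \in unitmx -> invmx P + S \in unitmx ->
  invmx (1%:M + P *m S) = invmx (invmx P + S) *m invmx P.
Proof.
by move=> uP uS; rewrite -(mulmxV uP) -mulmxDr invmx_mul_unit.
Qed.

(** The claimed inverse is checked as a right inverse, with [B U^-1 A] rewritten as [V - W^-1]; for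
    square matrices this also makes [U + A W B] invertible. *)
Lemma woodbury A B U W : U \in unitmx -> W \in unitmx ->
    invmx W + B *m invmx U *m A \in unitmx ->
  invmx (U + A *m W *m B) =
    invmx U
    - invmx U *m A *m invmx (invmx W + B *m invmx U *m A) *m B *m invmx U.
Proof.
move=> uU uW; set V := invmx W + _ => uV.
set Y := invmx U - _.
have VE : B *m invmx U *m A = V - invmx W by rewrite /V addrC addKr.
suff YE : (U + A *m W *m B) *m Y = 1%:M.
  have [u1 _] := mulmx1_unit YE.
  by rewrite -[LHS]mulmx1 -YE mulKmx.
rewrite /Y mulmxBr !mulmxDl mulmxV //.
have -> : U *m (invmx U *m A *m invmx V *m B *m invmx U)
    = A *m invmx V *m B *m invmx U by rewrite !mulmxA mulmxV // mul1mx.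
have -> : A *m W *m B *m (invmx U *m A *m invmx V *m B *m invmx U)
    = A *m W *m (B *m invmx U *m A) *m invmx V *m B *m invmx U.
  by rewrite !mulmxA.
rewrite VE mulmxBr !mulmxBl (mulmxK uW) (mulmxK uV).
by rewrite [X in _ - X]addrC subrK addrK.
Qed.

Lemma riccati_lyapunov A R S P Q :
    P^T = P -> S^T = S -> P \in unitmx -> Q \in unitmx ->
    invmx P + S \in unitmx -> invmx Q + R \in unitmx ->
    invmx P + Q \in unitmx ->
    P = A *m invmx (1%:M + P *m S) *m P *m A^T + R ->
    Q = A^T *m invmx (1%:M + Q *m R) *m Q *m A + S ->
  let H := invmx (P + invmx Q) in
  let E := A *m invmx (1%:M + P *m S) in
  H = E^T *m H *m E + S *m invmx (1%:M + P *m S).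
Proof.
move=> symP symS uP uQ uW uT uV.
rewrite !invmx_add1_mul // => Pfix Qfix /=.
(* Here [W'] and [T'] stand for [W^-1] and [T^-1], not for transposes. *)
set W' := invmx P + S in uW Pfix *.
set T' := invmx Q + R in uT Qfix *.
set V := invmx P + Q in uV *.
have PE : P = A *m invmx W' *m A^T + R.
  by rewrite {1}Pfix !mulmxA (mulmxKV uP).
have QE : A^T *m invmx T' *m A = V - W'.
  have {}Qfix : Q = A^T *m invmx T' *m A + S by rewrite {1}Qfix !mulmxA (mulmxKV uQ).
  by rewrite /V /W' {1}Qfix opprD addrACA subrr add0r addrK.
have HE1 : invmx (P + invmx Q) =
    invmx T' - invmx T' *m A *m invmx V *m A^T *m invmx T'.
  have VE : invmx (invmx W') + A^T *m invmx T' *m A = V.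
    by rewrite invmxK QE addrC subrK.
  have -> : P + invmx Q = T' + A *m invmx W' *m A^T.
    by rewrite {1}PE -addrA addrC [R + _]addrC.
  by rewrite woodbury ?unitmx_inv ?VE.
have HE2 : invmx (P + invmx Q) =
    invmx P - invmx P *m invmx V *m invmx P.
  have := @woodbury 1%:M 1%:M P (invmx Q) uP.
  rewrite unitmx_inv invmxK !mulmx1 !mul1mx [Q + _]addrC.
  exact.
have symW : (invmx W')^T = invmx W'.
  by rewrite trmx_inv linearD /= trmx_inv symP symS.
rewrite !trmx_mul symW trmx_inv symP.
have -> : invmx P *m invmx W' *m A^T *m invmx (P + invmx Q)
      *m (A *m (invmx W' *m invmx P)) =
    invmx P *m (invmx W' *m (A^T *m invmx (P + invmx Q) *m A) *m invmx W')
      *m invmx P by rewrite !mulmxA.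
(* With [A^T T A = V - W'], the left side is [(V - W') - (V - W') V^-1 (V - W')], which
   collapses. *)
have -> : A^T *m invmx (P + invmx Q) *m A = W' - W' *m invmx V *m W'.
  rewrite HE1 mulmxBr mulmxBl.
  have -> : A^T *m (invmx T' *m A *m invmx V *m A^T *m invmx T') *m A =
      (A^T *m invmx T' *m A) *m invmx V *m (A^T *m invmx T' *m A).
    by rewrite !mulmxA.
  rewrite QE (mulmxBl V W' (invmx V)) (mulmxV uV) [in X in _ - X]mulmxBl.
  by rewrite mul1mx mulmxBr (mulmxKV uV) opprB addrC subrK.
(* This turns [F = S W P^-1] into [P^-1 - P^-1 W P^-1], whose last term cancels against
   [E^T H E = P^-1 (W - V^-1) P^-1]. *)
have -> : S = W' - invmx P by rewrite /W' addrC addKr.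
rewrite HE2 (mulmxBr (invmx W')) (mulmxBl _ _ (invmx W')) (mulVmx uW) mul1mx.
rewrite !mulmxA (mulVmx uW) mul1mx (mulmxK uW) mulmxBr !mulmxBl.
by rewrite (mulmxV uW) mul1mx [RHS]addrC [RHS]addrA subrK.
Qed.

End MatrixIdentities.

(** * Quadratic forms and traces *)

Section PositiveDefinite.

Variables (K : realType) (r : nat).
Implicit Types P S : 'M[K]_r.

Lemma posdefmx_unit P : posdefmx P -> P \in unitmx.
Proof.
case=> symP posP; rewrite -row_free_unit -kermx_eq0.
apply/eqP/row_matrixP => i; rewrite row0; apply/eqP/negPn/negP => nz.
have := posP (row i (kermx P))^T.
rewrite trmx_eq0 trmxK => /(_ nz).
by rewrite -row_mul mulmx_ker row0 mul0mx mxE ltxx.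
Qed.

Lemma posdefmx_inv P : posdefmx P -> posdefmx (invmx P).
Proof.
move=> pdP; have uP := posdefmx_unit pdP; case: pdP => symP posP.
have symV : (invmx P)^T = invmx P by rewrite trmx_inv symP.
(* The form of [P^-1] at [x] is the form of [P] at [P^-1 x]. *)
split=> // x nz; have := posP (invmx P *m x).
rewrite trmx_mul symV -!mulmxA (mulKVmx uP) => -> //.
by apply: contraNneq nz => Px0; rewrite -(mulKVmx uP x) Px0 mulmx0.
Qed.

Lemma posdefmx_add_psd P S : posdefmx P -> psdmx S -> posdefmx (P + S).
Proof.
move=> [symP posP] [symS posS]; split=> [|x nz]; first by rewrite linearD /= symP symS.
by rewrite mulmxDr mulmxDl mxE ltr_wpDr ?posP.
Qed.

Lemma posdefmx_psd P : posdefmx P -> psdmx P.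
Proof.
move=> [symP posP]; split=> // x; have [->|/posP/ltW //] := eqVneq x 0.
by rewrite mulmx0 mxE.
Qed.

(** The diagonal of [B^T P B] holds the values of the form at the columns of [B], so sign and
    vanishing of the trace can be read off column by column. *)
Lemma mxtrace_congr n P (B : 'M[K]_(r, n)) :
  \tr (B^T *m P *m B) = \sum_i ((col i B)^T *m P *m col i B) 0 0.
Proof.
apply: eq_bigr => i _.
rewrite tr_col -row_mul; set N := B^T *m P.
by rewrite !mxE; apply: eq_bigr => j _; rewrite !mxE.
Qed.

Lemma mxtrace_congr_ge0 n P (B : 'M[K]_(r, n)) :
  psdmx P -> 0 <= \tr (B^T *m P *m B).
Proof. by move=> [_ posP]; rewrite mxtrace_congr sumr_ge0. Qed.

Lemma mxtrace_congr_eq0 n P (B : 'M[K]_(r, n)) :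
  posdefmx P -> \tr (B^T *m P *m B) = 0 -> B = 0.
Proof.
move=> pdP; rewrite mxtrace_congr => /eqP.
rewrite psumr_eq0 => [/allP B0|i _]; last by have [_ ->] := posdefmx_psd pdP.
have col0 i : col i B = 0.
  apply/eqP/negPn/negP => nz; have [_ posP] := pdP.
  by have := B0 i (mem_index_enum i); rewrite gt_eqF ?posP.
apply/matrixP => i j; have := congr1 (fun M : 'cV_r => M i 0) (col0 j).
by rewrite !mxE.
Qed.

End PositiveDefinite.

(** * The homogeneous Lyapunov equation *)

Section Stein.

Variables (K : realType) (r : nat).
Implicit Types A B E P X : 'M[K]_r.

Lemma stein_annihilator m n E P X (G1 : 'M[K]_(r, m)) (G2 : 'M[K]_(r, n)) :
    posdefmx P -> P = E *m P *m E^T + (G1 *m G1^T + G2 *m G2^T) ->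
    X = E^T *m X *m E ->
  G1^T *m X = 0 /\ G2^T *m X = 0.
Proof.
move=> pdP PE XE.
(* Both [X] and [X^T] are expanded by the equation, then the trailing [E] is cycled to the front. *)
have eqT : \tr (P *m X *m P *m X^T) =
    \tr ((E *m P *m E^T) *m X *m (E *m P *m E^T) *m X^T).
  by rewrite {1 2}XE !trmx_mul trmxK !mulmxA mxtrace_mulC !mulmxA.
have psdP := posdefmx_psd pdP.
have split1 k (G : 'M[K]_(r, k)) :
    \tr (G *m G^T *m X *m P *m X^T) = \tr ((X^T *m G)^T *m P *m (X^T *m G)).
  by rewrite -!mulmxA mxtrace_mulC trmx_mul trmxK !mulmxA.
have split2 k (G : 'M[K]_(r, k)) :
    \tr (E *m P *m E^T *m X *m (G *m G^T) *m X^T) =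
    \tr ((E^T *m X *m G)^T *m P *m (E^T *m X *m G)).
  by rewrite mxtrace_mulC !mulmxA mxtrace_mulC !trmx_mul trmxK !mulmxA
    mxtrace_mulC !mulmxA.
move: eqT; set N := E *m P *m E^T in PE split2 *.
set C := G1 *m G1^T + G2 *m G2^T in PE.
(* The second [P] is split only beside [N]; kept intact beside [C], its definiteness yields
   [X^T G1 = 0] and [X^T G2 = 0]. *)
have -> : \tr (P *m X *m P *m X^T) =
  \tr (C *m X *m P *m X^T) + (\tr (N *m X *m C *m X^T) + \tr (N *m X *m N *m X^T)).
  by rewrite {1}PE mulmxDl mulmxDl mulmxDl addrC linearD /= {2}PE
    mulmxDr mulmxDl linearD /= [X in _ + X]addrC.
rewrite /C !(mulmxDl, mulmxDr) !linearD /= !split1 !split2 addrA => /eqP.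
rewrite -subr_eq0 addrK paddr_eq0 ?addr_ge0 ?mxtrace_congr_ge0 //.
rewrite paddr_eq0 ?mxtrace_congr_ge0 // => /andP[/andP[/eqP G1X /eqP G2X] _].
split; apply: trmx_inj; rewrite trmx0 trmx_mul trmxK;
  exact: mxtrace_congr_eq0 pdP _.
Qed.

(** [X^T] kills every block [A^k B] of the controllability matrix, whose rows are independent. *)
Lemma controllable_annihilator A B X :
  controllable A B -> (forall k, B^T *m A^T ^+ k *m X = 0) -> X = 0.
Proof.
move=> ctrl BAX0; apply: trmx_inj; rewrite trmx0.
have full : row_free (\mxrow_(k < r) (A ^+ k *m B)) by rewrite /row_free ctrl.
apply: (row_free_inj full); rewrite mul0mx mul_mxrow.
apply/mxrowP => k; rewrite mxrowK submxrow0.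
apply: trmx_inj; rewrite trmx0 !trmx_mul trmxK -(BAX0 k).
suff -> : (A ^+ k)^T = A^T ^+ k by [].
elim: (k : nat) => [|m IHm]; first by rewrite !expr0 trmx1.
by rewrite exprS exprSr trmx_mul IHm.
Qed.

End Stein.

Lemma riccati_stein_unique (K : realType) (r : nat)
    (A R S Rhalf Shalf P X : 'M[K]_r) :
    let E := A *m invmx (1%:M + P *m S) in
    symmetric_sqrtmx R Rhalf -> symmetric_sqrtmx S Shalf ->
    controllable A Rhalf -> posdefmx P -> 1%:M + P *m S \in unitmx ->
    P = riccati A R S P -> X = E^T *m X *m E -> X = 0.
Proof.
move=> E [symRh RhE] [symSh ShE] ctrl pdP uPS PE XE.
have symP : P^T = P by case: pdP.
have symS : S^T = S by rewrite -ShE trmx_mul symSh.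
have AE : A = E *m (1%:M + P *m S) by rewrite /E (mulmxKV uPS).
rewrite /riccati -/E in PE; clearbody E.
have ATE : A^T = E^T + S *m P *m E^T.
  by rewrite {1}AE trmx_mul linearD /= trmx1 trmx_mul symP symS mulmxDl mul1mx.
(* Inserting [A^T] in [P = E P A^T + R] adds the term [E P S P E^T], which is [G G^T] for
   [G = E P S^(1/2)]. *)
have PE' : P = E *m P *m E^T
    + ((E *m P *m Shalf) *m (E *m P *m Shalf)^T + Rhalf *m Rhalf^T).
  rewrite {1}PE ATE mulmxDr symRh RhE -addrA !trmx_mul symSh symP.
  by rewrite -ShE !mulmxA.
(* Since [A^T Y = E^T Y], the product [A^T Y] solves the same equation, so the step can be
   iterated. *)
have step Y : Y = E^T *m Y *m E ->
    [/\ Rhalf^T *m Y = 0, A^T *m Y = E^T *m Y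
      & A^T *m Y = E^T *m (A^T *m Y) *m E].
  move=> YE; have [SY RY] := stein_annihilator pdP PE' YE.
  have AY : A^T *m Y = E^T *m Y.
    move: SY; rewrite !trmx_mul symSh symP -!mulmxA => SY.
    by rewrite ATE mulmxDl -ShE -!mulmxA SY mulmx0 addr0.
  by split=> //; rewrite AY {1}YE !mulmxA.
apply: (controllable_annihilator ctrl) => k.
have AkE : A^T ^+ k *m X = E^T *m (A^T ^+ k *m X) *m E.
  elim: k => [|k IHk]; first by rewrite expr0 mul1mx.
  have -> : A^T ^+ k.+1 *m X = A^T *m (A^T ^+ k *m X) by rewrite exprS mulmxA.
  by have [] := step _ IHk.
by rewrite -mulmxA; have [] := step _ AkE.
Qed.

Theorem corollary1p2 (K : realType) (r : nat) (r_ge1 : (1 <= r)%N)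
    (A R S Rhalf Shalf P Phat : 'M[K]_r)
    (R_psd : psdmx R) (S_psd : psdmx S)
    (Rhalf_sqrt : symmetric_sqrtmx R Rhalf)
    (Shalf_sqrt : symmetric_sqrtmx S Shalf)
    (A_ctrl : controllable A Rhalf) (A_obs : observable A Shalf)
    (P_posdef : posdefmx P) (P_fix : P = riccati A R S P)
    (Phat_posdef : posdefmx Phat) (Phat_fix : Phat = riccati_dual A R S Phat) :
  let H := invmx (P + invmx Phat) in
  let E := A *m invmx (1%:M + P *m S) in
  let F := S *m invmx (1%:M + P *m S) in
  H = E^T *m H *m E + F /\
  (forall X : 'M[K]_r, X = E^T *m X *m E + F -> X = H).
Proof.
move=> H E F.
have uP := posdefmx_unit P_posdef; have uQ := posdefmx_unit Phat_posdef.
have iP := posdefmx_inv P_posdef; have iQ := posdefmx_inv Phat_posdef.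
have uW := posdefmx_unit (posdefmx_add_psd iP S_psd).
have uT := posdefmx_unit (posdefmx_add_psd iQ R_psd).
have uV := posdefmx_unit (posdefmx_add_psd iP (posdefmx_psd Phat_posdef)).
have HE : H = E^T *m H *m E + F.
  by apply: riccati_lyapunov P_fix Phat_fix => //; [case: P_posdef|case: S_psd].
(* [F] cancels in the difference [X - H], which solves the homogeneous equation. *)
split=> // X XE; apply/eqP; rewrite -subr_eq0; apply/eqP.
apply: (riccati_stein_unique Rhalf_sqrt Shalf_sqrt A_ctrl P_posdef _ P_fix).
  exact: unitmx_add1_mul.
by rewrite -/E {1}XE {1}HE mulmxBr mulmxBl opprD addrACA subrr addr0.
Qed.
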